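(* Let $N$ and $H$ be monoids. There is an equivalence of categories between the category of weakly Schreier extensions of monoids with kernel $N$ and cokernel $H$ and the category of normal lax monoidal functors from $H$ (viewed as a discrete monoidal category) to the monoidal category $\mathrm{End}_{\mathbf{LQBiset}}(N)$ and monoidal natural transformations between them.
   Context: Extensions. An extension of monoids with kernel $N$ and cokernel $H$ is a diagram $N \xrightarrow{k} G \xrightarrow{e} H$ of monoid homomorphisms in which $k$ is the kernel of $e$ (i.e. $k$ is injective with image $e^{-1}(1)$) and $e$ is the cokernel of $k$ in the category of monoids. It is weakly Schreier if for every $h \in H$ there is a $u_h \in e^{-1}(h)$ such that for each $g \in e^{-1}(h)$ there is a (not necessarily unique) $n \in N$ with $k(n)u_h = g$. A morphism from $N \xrightarrow{k} G \xrightarrow{e} H$ to $N \xrightarrow{k'} G' \xrightarrow{e'} H$ is a monoid homomorphism $t\colon G \to G'$ with $tk = k'$ and $e't = e$. Bisets. An $(M,N)$-biset is a set $X$ with a left action of the monoid $M$ and a right action of the monoid $N$ such that $(m\cdot x)\cdot n = m\cdot(x\cdot n)$. If $X$ is an $(L,M)$-biset and $Y$ is an $(M,N)$-biset, then $X \otimes Y$ is the $(L,N)$-biset given by the quotient of $X \times Y$ by the equivalence relation generated by $(x\cdot m, y) \sim (x, m\cdot y)$, with the evident actions. $\mathbf{Biset}$ is the bicategory of monoids, bisets (with $(M,N)$-bisets as 1-morphisms $N\to M$) and biset homomorphisms, with horizontal composition given by tensor product. $\mathbf{LQBiset}$ is its sub-bicategory with the same objects, with 1-morphisms $N \to M$ those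 $(M,N)$-bisets which as left $M$-sets are quotients of $M$ (with left action by multiplication), with arbitrary compatible right $N$-action, and with all biset homomorphisms between these as 2-morphisms. Thus $\mathrm{End}_{\mathbf{LQBiset}}(N)$ is the monoidal category of $(N,N)$-bisets which as left $N$-sets are quotients of $N$, and biset homomorphisms, with tensor product $\otimes$ and unit $I = N$ with both actions given by multiplication. Monoidal functors. The monoid $H$ is viewed as a discrete monoidal category: its objects are the elements of $H$, its only morphisms are identities, and its tensor product is multiplication. A lax monoidal functor $L$ has a unit map $\iota^L\colon I \to L(1)$ and structure maps $\gamma^L_{x,y}\colon L(x) \otimes L(y) \to L(xy)$ satisfying the usual unit and associativity axioms; it is normal if its unit map $\iota^L$ is an identity morphism (in particular $L(1) = I$). A monoidal natural transformation $\tau\colon L_1 \to L_2$ is a natural transformation with $\tau_I\, \iota^{L_1} = \iota^{L_2}$ and $\tau_{x\otimes y}\,\gamma^{L_1}_{x,y} = \gamma^{L_2}_{x,y}(\tau_x \otimes \tau_y)$ for all objects $x,y$ of the domain (with $I$ in $\tau_I$ denoting the monoidal unit of the domain). *)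

(* Defs.v *)
From HB Require Import structures.
From mathcomp Require Import all_boot.
From mathcomp Require Import boolp.
From Stdlib Require Import Relation_Operators.

Set Implicit Arguments.
Unset Strict Implicit.
Unset Printing Implicit Defensive.

Local Open Scope group_scope.
Local Open Scope quotient_scope.

Record category := Category {
  ob :> Type;
  hom : ob -> ob -> Type;
  idm : forall X, hom X X;
  comp : forall X Y Z, hom Y Z -> hom X Y -> hom X Z;
  comp_idl : forall X Y (f : hom X Y), comp (idm Y) f = f;
  comp_idr : forall X Y (f : hom X Y), comp f (idm X) = f;
  comp_assoc : forall X Y Z W (f : hom X Y) (g : hom Y Z) (h : hom Z W),
    comp h (comp g f) = comp (comp h g) f }.

Arguments hom {c} X Y.
Arguments idm {c} X.
Arguments comp {c X Y Z} g f : rename.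

Notation "g ∘ f" := (comp g f) (at level 40, left associativity).

Definition is_iso (C : category) (X Y : C) (f : hom X Y) : Prop :=
  exists g : hom Y X, g ∘ f = idm X /\ f ∘ g = idm Y.

(* The morphism f : X -> Y is an identity morphism; this entails that the
   objects X and Y are equal, not merely isomorphic. *)
Inductive is_identity (C : category) (X : C) : forall Y : C, hom X Y -> Prop :=
  is_identity_idm : is_identity (idm X).

Record functor (C D : category) := Functor {
  fob :> C -> D;
  fmap : forall X Y : C, hom X Y -> hom (fob X) (fob Y);
  fmap_id : forall X : C, fmap (idm X) = idm (fob X);
  fmap_comp : forall (X Y Z : C) (f : hom X Y) (g : hom Y Z),
    fmap (g ∘ f) = fmap g ∘ fmap f }.

Arguments fmap {C D} F {X Y} f : rename.

Definition functor_id (C : category) : functor C C :=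
  @Functor C C id (fun _ _ f => f) (fun _ => erefl) (fun _ _ _ _ _ => erefl).

Lemma functor_comp_id (C D E : category) (G : functor D E) (F : functor C D) X :
  fmap G (fmap F (idm X)) = idm (G (F X)).
Proof. by rewrite !fmap_id. Qed.

Lemma functor_comp_comp (C D E : category) (G : functor D E) (F : functor C D)
    (X Y Z : C) (f : hom X Y) (g : hom Y Z) :
  fmap G (fmap F (g ∘ f)) = fmap G (fmap F g) ∘ fmap G (fmap F f).
Proof. by rewrite !fmap_comp. Qed.

Definition functor_comp (C D E : category) (G : functor D E)
    (F : functor C D) : functor C E :=
  Functor (functor_comp_id G F) (functor_comp_comp G F).

Record nat_trans (C D : category) (F G : functor C D) := NatTrans {
  nt :> forall X : C, hom (F X) (G X);
  nt_natural : forall (X Y : C) (f : hom X Y),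
    nt Y ∘ fmap F f = fmap G f ∘ nt X }.

Definition nat_isomorphic (C D : category) (F G : functor C D) : Prop :=
  exists t : nat_trans F G, forall X, is_iso (t X).

Definition equivalent_categories (C D : category) : Prop :=
  exists (F : functor C D) (G : functor D C),
    nat_isomorphic (functor_comp G F) (functor_id C) /\
    nat_isomorphic (functor_comp F G) (functor_id D).

Definition full_subcat (C : category) (P : C -> Prop) : category :=
  @Category {X : C | P X} (fun X Y => hom (sval X) (sval Y))
    (fun X => idm (sval X)) (fun X Y Z g f => g ∘ f)
    (fun X Y f => comp_idl f) (fun X Y f => comp_idr f)
    (fun X Y Z W f g h => comp_assoc f g h).

Record moncat := MonCat {
  mcat :> category;
  mtens : mcat -> mcat -> mcat;
  mtensm : forall X X' Y Y' : mcat,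
    hom X X' -> hom Y Y' -> hom (mtens X Y) (mtens X' Y');
  munit : mcat;
  massoc : forall X Y Z : mcat,
    hom (mtens (mtens X Y) Z) (mtens X (mtens Y Z));
  mlunit : forall X : mcat, hom (mtens munit X) X;
  mrunit : forall X : mcat, hom (mtens X munit) X;
  mtensm_id : forall X Y : mcat, mtensm (idm X) (idm Y) = idm (mtens X Y);
  mtensm_comp : forall (X X' X'' Y Y' Y'' : mcat)
      (f : hom X X') (f' : hom X' X'') (g : hom Y Y') (g' : hom Y' Y''),
    mtensm (f' ∘ f) (g' ∘ g) = mtensm f' g' ∘ mtensm f g;
  massoc_natural : forall (X X' Y Y' Z Z' : mcat)
      (f : hom X X') (g : hom Y Y') (h : hom Z Z'),
    massoc X' Y' Z' ∘ mtensm (mtensm f g) h =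
    mtensm f (mtensm g h) ∘ massoc X Y Z;
  mlunit_natural : forall (X X' : mcat) (f : hom X X'),
    mlunit X' ∘ mtensm (idm munit) f = f ∘ mlunit X;
  mrunit_natural : forall (X X' : mcat) (f : hom X X'),
    mrunit X' ∘ mtensm f (idm munit) = f ∘ mrunit X;
  massoc_iso : forall X Y Z, is_iso (massoc X Y Z);
  mlunit_iso : forall X, is_iso (mlunit X);
  mrunit_iso : forall X, is_iso (mrunit X);
  mtriangle : forall X Y : mcat,
    mtensm (idm X) (mlunit Y) ∘ massoc X munit Y = mtensm (mrunit X) (idm Y);
  mpentagon : forall X Y Z W : mcat,
    massoc X Y (mtens Z W) ∘ massoc (mtens X Y) Z W =
    mtensm (idm X) (massoc Y Z W) ∘
      (massoc X (mtens Y Z) W ∘ mtensm (massoc X Y Z) (idm W)) }.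

Arguments mtens {m} X Y.
Arguments mtensm {m X X' Y Y'} f g.
Arguments munit {m}.
Arguments massoc {m} X Y Z.
Arguments mlunit {m} X.
Arguments mrunit {m} X.

Record lax_functor (C D : moncat) := LaxFunctor {
  lax_fun :> functor C D;
  lax_unit : hom munit (lax_fun munit);
  lax_mult : forall X Y : C,
    hom (mtens (lax_fun X) (lax_fun Y)) (lax_fun (mtens X Y));
  lax_mult_natural : forall (X X' Y Y' : C) (f : hom X X') (g : hom Y Y'),
    lax_mult X' Y' ∘ mtensm (fmap lax_fun f) (fmap lax_fun g) =
    fmap lax_fun (mtensm f g) ∘ lax_mult X Y;
  lax_assoc : forall X Y Z : C,
    fmap lax_fun (massoc X Y Z) ∘
      (lax_mult (mtens X Y) Z ∘ mtensm (lax_mult X Y) (idm (lax_fun Z))) =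
    lax_mult X (mtens Y Z) ∘
      (mtensm (idm (lax_fun X)) (lax_mult Y Z) ∘
        massoc (lax_fun X) (lax_fun Y) (lax_fun Z));
  lax_lunit : forall X : C,
    fmap lax_fun (mlunit X) ∘
      (lax_mult munit X ∘ mtensm lax_unit (idm (lax_fun X))) =
    mlunit (lax_fun X);
  lax_runit : forall X : C,
    fmap lax_fun (mrunit X) ∘
      (lax_mult X munit ∘ mtensm (idm (lax_fun X)) lax_unit) =
    mrunit (lax_fun X) }.

Arguments lax_unit {C D} l.
Arguments lax_mult {C D} l X Y.

Definition normal (C D : moncat) (L : lax_functor C D) : Prop :=
  is_identity (lax_unit L).

Record mon_trans (C D : moncat) (L1 L2 : lax_functor C D) := MonTrans {
  mt_nat :> nat_trans L1 L2;
  mt_unit : mt_nat munit ∘ lax_unit L1 = lax_unit L2;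
  mt_mult : forall X Y : C,
    mt_nat (mtens X Y) ∘ lax_mult L1 X Y =
    lax_mult L2 X Y ∘ mtensm (mt_nat X) (mt_nat Y) }.

Lemma mon_trans_ext (C D : moncat) (L1 L2 : lax_functor C D)
    (s t : mon_trans L1 L2) : (forall X, s X = t X) -> s = t.
Proof.
case: s t => [[s sn] su sm] [[t tn] tu tm] /= st.
have {}st : s = t by apply: functional_extensionality_dep.
subst t; rewrite (Prop_irrelevance sn tn) in su sm *.
by rewrite (Prop_irrelevance su tu) (Prop_irrelevance sm tm).
Qed.

Section LaxCategory.
Variables C D : moncat.

Fact mon_trans_id_natural (L : lax_functor C D) (X Y : C) (f : hom X Y) :
  idm (L Y) ∘ fmap L f = fmap L f ∘ idm (L X).
Proof. by rewrite comp_idl comp_idr. Qed.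

Fact mon_trans_id_unit (L : lax_functor C D) :
  idm (L munit) ∘ lax_unit L = lax_unit L.
Proof. exact: comp_idl. Qed.

Fact mon_trans_id_mult (L : lax_functor C D) (X Y : C) :
  idm (L (mtens X Y)) ∘ lax_mult L X Y =
  lax_mult L X Y ∘ mtensm (idm (L X)) (idm (L Y)).
Proof. by rewrite mtensm_id comp_idl comp_idr. Qed.

Definition mon_trans_id (L : lax_functor C D) : mon_trans L L :=
  @MonTrans C D L L (NatTrans (@mon_trans_id_natural L))
    (mon_trans_id_unit L) (mon_trans_id_mult L).

Variables (L1 L2 L3 : lax_functor C D).
Variables (t : mon_trans L2 L3) (s : mon_trans L1 L2).

Fact mon_trans_comp_natural (X Y : C) (f : hom X Y) :
  (t Y ∘ s Y) ∘ fmap L1 f = fmap L3 f ∘ (t X ∘ s X).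
Proof. by rewrite -comp_assoc nt_natural comp_assoc nt_natural comp_assoc. Qed.

Fact mon_trans_comp_unit : (t munit ∘ s munit) ∘ lax_unit L1 = lax_unit L3.
Proof. by rewrite -comp_assoc !mt_unit. Qed.

Fact mon_trans_comp_mult (X Y : C) :
  (t (mtens X Y) ∘ s (mtens X Y)) ∘ lax_mult L1 X Y =
  lax_mult L3 X Y ∘ mtensm (t X ∘ s X) (t Y ∘ s Y).
Proof. by rewrite -comp_assoc mt_mult comp_assoc mt_mult mtensm_comp comp_assoc. Qed.

Definition mon_trans_comp : mon_trans L1 L3 :=
  @MonTrans C D L1 L3
    (@NatTrans _ _ L1 L3 (fun X => t X ∘ s X) mon_trans_comp_natural)
    mon_trans_comp_unit mon_trans_comp_mult.

End LaxCategory.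

Definition lax_category (C D : moncat) : category.
Proof.
refine (@Category (lax_functor C D) (@mon_trans C D) (@mon_trans_id C D)
  (@mon_trans_comp C D) _ _ _) => *; apply: mon_trans_ext => X /=.
- exact: comp_idl.
- exact: comp_idr.
- exact: comp_assoc.
Defined.

Definition normal_lax_category (C D : moncat) : category :=
  @full_subcat (lax_category C D) (@normal C D).

Section FullMonSubcat.
Variables (C : moncat) (P : C -> Prop).
Hypothesis P1 : P munit.
Hypothesis PM : forall X Y, P X -> P Y -> P (mtens X Y).

Let tens (X Y : full_subcat P) : full_subcat P :=
  exist P (mtens (sval X) (sval Y)) (PM (proj2_sig X) (proj2_sig Y)).

Definition full_sub_moncat : moncat :=
  @MonCat (full_subcat P) tens
    (fun X X' Y Y' f g => @mtensm C (sval X) (sval X') (sval Y) (sval Y') f g)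
    (exist P munit P1)
    (fun X Y Z => massoc (sval X) (sval Y) (sval Z))
    (fun X => mlunit (sval X)) (fun X => mrunit (sval X))
    (fun X Y => mtensm_id (sval X) (sval Y))
    (fun X X' X'' Y Y' Y'' f f' g g' => mtensm_comp f f' g g')
    (fun X X' Y Y' Z Z' f g h => massoc_natural f g h)
    (fun X X' f => mlunit_natural f) (fun X X' f => mrunit_natural f)
    (fun X Y Z => massoc_iso (sval X) (sval Y) (sval Z))
    (fun X => mlunit_iso (sval X)) (fun X => mrunit_iso (sval X))
    (fun X Y => mtriangle (sval X) (sval Y))
    (fun X Y Z W => mpentagon (sval X) (sval Y) (sval Z) (sval W)).

End FullMonSubcat.

(* The hom-types are the propositions x = y, so each has at most one element. *)
Definition discrete_category (T : Type) : category :=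
  @Category T (fun x y => x = y) (@erefl T) (fun x y z q p => etrans p q)
    (fun _ _ _ => Prop_irrelevance _ _) (fun _ _ _ => Prop_irrelevance _ _)
    (fun _ _ _ _ _ _ _ => Prop_irrelevance _ _).

Lemma discrete_is_iso (T : Type) (x y : discrete_category T) (f : hom x y) :
  is_iso f.
Proof. by exists (esym f); split; apply: (@Prop_irrelevance (_ = _ :> T)). Qed.

Definition discrete_moncat (H : monoidType) : moncat.
Proof.
refine (@MonCat (discrete_category H) (fun x y => x * y)
  (fun x x' y y' p q => f_equal2 (fun a b : H => a * b) p q) 1
  (fun x y z => esym (mulgA x y z)) (@mul1g H) (@mulg1 H)
  _ _ _ _ _ _ _ _ _ _) => *;
  first [exact: discrete_is_iso | exact: (@Prop_irrelevance (_ = _ :> H))].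
Defined.

Record biset (M N : monoidType) := Biset {
  bset :> Type;
  lact : M -> bset -> bset;
  ract : bset -> N -> bset;
  lact1 : forall x, lact 1 x = x;
  lactM : forall m m' x, lact (m * m') x = lact m (lact m' x);
  ract1 : forall x, ract x 1 = x;
  ractM : forall x n n', ract x (n * n') = ract (ract x n) n';
  lractA : forall m x n, ract (lact m x) n = lact m (ract x n) }.

Arguments lact {M N b} m x.
Arguments ract {M N b} x n.

Record biset_hom (M N : monoidType) (X Y : biset M N) := BisetHom {
  bfun :> X -> Y;
  bfun_lact : forall m x, bfun (lact m x) = lact m (bfun x);
  bfun_ract : forall x n, bfun (ract x n) = ract (bfun x) n }.

Lemma biset_hom_ext (M N : monoidType) (X Y : biset M N) (f g : biset_hom X Y) :
  (forall x, f x = g x) -> f = g.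
Proof.
case: f g => [f fl fr] [g gl gr] /= fg.
have {}fg : f = g by apply: functional_extensionality_dep.
by subst g; rewrite (Prop_irrelevance fl gl) (Prop_irrelevance fr gr).
Qed.

Definition biset_hom_id (M N : monoidType) (X : biset M N) : biset_hom X X :=
  @BisetHom M N X X id (fun _ _ => erefl) (fun _ _ => erefl).

Definition biset_hom_comp (M N : monoidType) (X Y Z : biset M N)
  (g : biset_hom Y Z) (f : biset_hom X Y) : biset_hom X Z.
Proof.
exists (fun x => g (f x)) => [m x|x n].
- by rewrite !bfun_lact.
- by rewrite !bfun_ract.
Defined.

Definition biset_category (M N : monoidType) : category.
Proof.
by refine (@Category (biset M N) (@biset_hom M N) (@biset_hom_id M N)
  (@biset_hom_comp M N) _ _ _) => *; apply: biset_hom_ext.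
Defined.

Definition regular_biset (N : monoidType) : biset N N :=
  @Biset N N N (fun n x => n * x) (fun x n => x * n)
    (@mul1g N) (fun m m' x => esym (mulgA m m' x))
    (@mulg1 N) (@mulgA N) (fun m x n => esym (mulgA m x n)).

Section Tensor.
Variables (L M N : monoidType) (X : biset L M) (Y : biset M N).

Inductive tensor_step : X * Y -> X * Y -> Prop :=
  TensorStep x m y : tensor_step (ract x m, y) (x, lact m y).

Definition tensor_rel : rel {classic (X * Y)} :=
  fun p q => `[< clos_refl_sym_trans (X * Y) tensor_step p q >].

Fact tensor_rel_refl : reflexive tensor_rel.
Proof. by move=> p; apply/asboolP; apply: rst_refl. Qed.

Fact tensor_rel_sym : symmetric tensor_rel.
Proof. by move=> p q; apply/asboolP/asboolP; apply: rst_sym. Qed.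

Fact tensor_rel_trans : transitive tensor_rel.
Proof.
by move=> q p r /asboolP pq /asboolP qr; apply/asboolP/(rst_trans _ _ _ q).
Qed.

Canonical tensor_equiv :=
  EquivRel tensor_rel tensor_rel_refl tensor_rel_sym tensor_rel_trans.

Definition tensor_set : Type := {eq_quot tensor_equiv}.

Definition tpair (x : X) (y : Y) : tensor_set :=
  \pi_({eq_quot tensor_equiv}) ((x, y) : {classic (X * Y)}).

Lemma tpair_bal x m y : tpair (ract x m) y = tpair x (lact m y).
Proof. by apply/eqmodP/asboolP/rst_step. Qed.

Lemma tensor_ind (P : tensor_set -> Prop) :
  (forall x y, P (tpair x y)) -> forall t, P t.
Proof. by move=> Pp; elim/quotW => -[x y]; apply: Pp. Qed.

(* Evaluates f on a chosen representative; meaningful only for balanced f. *)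
Definition tensor_lift (Z : Type) (f : X -> Y -> Z) (t : tensor_set) : Z :=
  let p := repr (t : {eq_quot tensor_equiv}) in f p.1 p.2.

Lemma tensor_liftE (Z : Type) (f : X -> Y -> Z) :
  (forall x m y, f (ract x m) y = f x (lact m y)) ->
  forall x y, tensor_lift f (tpair x y) = f x y.
Proof.
move=> fbal x y; rewrite /tensor_lift /tpair.
have E p q : clos_refl_sym_trans _ tensor_step p q -> f p.1 p.2 = f q.1 q.2.
  by elim=> [_ _ [x' m y'] /=|//|p' q' _ ->|p' q' r' _ -> _ ->] //; apply: fbal.
by case: piP => p /eqmodP/asboolP/E /= ->.
Qed.

End Tensor.

Arguments tpair {L M N X Y} x y.

Section TensorBiset.
Variables (L M N : monoidType) (X : biset L M) (Y : biset M N).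

Definition tensor_lact (l : L) : tensor_set X Y -> tensor_set X Y :=
  tensor_lift (fun x y => tpair (lact l x) y).

Definition tensor_ract (t : tensor_set X Y) (n : N) : tensor_set X Y :=
  tensor_lift (fun x y => tpair x (ract y n)) t.

Lemma tensor_lactE l x y : tensor_lact l (tpair x y) = tpair (lact l x) y.
Proof.
by rewrite /tensor_lact tensor_liftE // => x' m y'; rewrite -lractA tpair_bal.
Qed.

Lemma tensor_ractE x y n : tensor_ract (tpair x y) n = tpair x (ract y n).
Proof.
by rewrite /tensor_ract tensor_liftE // => x' m y'; rewrite lractA tpair_bal.
Qed.

Definition tensor : biset L N.
Proof.
exists (tensor_set X Y) tensor_lact tensor_ract.
- by elim/tensor_ind => x y; rewrite tensor_lactE lact1.
- by move=> l l'; elim/tensor_ind => x y; rewrite !tensor_lactE lactM.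
- by elim/tensor_ind => x y; rewrite tensor_ractE ract1.
- by elim/tensor_ind => x y n n'; rewrite !tensor_ractE ractM.
- by move=> l; elim/tensor_ind => x y n; rewrite !(tensor_lactE, tensor_ractE).
Defined.

End TensorBiset.

Section TensorHom.
Variables (L M N : monoidType) (X X' : biset L M) (Y Y' : biset M N).
Variables (f : biset_hom X X') (g : biset_hom Y Y').

Definition tensor_map : tensor X Y -> tensor X' Y' :=
  tensor_lift (fun x y => tpair (f x) (g y)).

Lemma tensor_mapE x y : tensor_map (tpair x y) = tpair (f x) (g y).
Proof.
rewrite /tensor_map tensor_liftE // => x' m y'.
by rewrite bfun_ract bfun_lact tpair_bal.
Qed.

Definition tensor_hom : biset_hom (tensor X Y) (tensor X' Y').
Proof.
exists tensor_map => [l|].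
- elim/tensor_ind => x y.
  by rewrite /= tensor_lactE !tensor_mapE /= tensor_lactE bfun_lact.
- elim/tensor_ind => x y n.
  by rewrite /= tensor_ractE !tensor_mapE /= tensor_ractE bfun_ract.
Defined.

End TensorHom.

Section TensorAssoc.
Variables (K L M N : monoidType).
Variables (X : biset K L) (Y : biset L M) (Z : biset M N).

Definition tensor_assoc_fun : tensor (tensor X Y) Z -> tensor X (tensor Y Z) :=
  tensor_lift (fun (t : tensor X Y) z => tensor_lift
    (fun x y => tpair x (tpair y z : tensor Y Z) : tensor X (tensor Y Z)) t).

Definition tensor_assoc_inv_fun :
    tensor X (tensor Y Z) -> tensor (tensor X Y) Z :=
  tensor_lift (fun x (t : tensor Y Z) => tensor_lift
    (fun y z => tpair (tpair x y : tensor X Y) z : tensor (tensor X Y) Z) t).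

Lemma tensor_assoc_funE x y z :
  tensor_assoc_fun (tpair (tpair x y : tensor X Y) z) =
  tpair x (tpair y z : tensor Y Z).
Proof.
have E t w u : tensor_lift (fun x y => tpair x (tpair y w : tensor Y Z) :
    tensor X (tensor Y Z)) (tpair t u) = tpair t (tpair u w : tensor Y Z).
  by rewrite tensor_liftE // => x' m y'; rewrite tpair_bal /= tensor_lactE.
rewrite /tensor_assoc_fun tensor_liftE ?E // => t m z'.
by elim/tensor_ind: t => x' y'; rewrite /= tensor_ractE !E tpair_bal.
Qed.

Lemma tensor_assoc_inv_funE x y z :
  tensor_assoc_inv_fun (tpair x (tpair y z : tensor Y Z)) =
  tpair (tpair x y : tensor X Y) z.
Proof.
have E t u w : tensor_lift (fun y z => tpair (tpair t y : tensor X Y) z :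
    tensor (tensor X Y) Z) (tpair u w) = tpair (tpair t u : tensor X Y) w.
  by rewrite tensor_liftE // => y' m z'; rewrite -tpair_bal /= tensor_ractE.
rewrite /tensor_assoc_inv_fun tensor_liftE ?E // => x' m t.
by elim/tensor_ind: t => y' z'; rewrite /= tensor_lactE !E tpair_bal.
Qed.

Definition tensor_assoc :
  biset_hom (tensor (tensor X Y) Z) (tensor X (tensor Y Z)).
Proof.
exists tensor_assoc_fun => [k|].
- elim/tensor_ind => t z; elim/tensor_ind: t => x y.
  rewrite /= tensor_lactE tensor_assoc_funE /= tensor_lactE tensor_assoc_funE.
  by rewrite tensor_lactE.
- elim/tensor_ind => t z n; elim/tensor_ind: t => x y.
  by rewrite /= tensor_ractE !tensor_assoc_funE tensor_ractE /= tensor_ractE.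
Defined.

Definition tensor_assoc_inv :
  biset_hom (tensor X (tensor Y Z)) (tensor (tensor X Y) Z).
Proof.
exists tensor_assoc_inv_fun => [k|].
- elim/tensor_ind => x t; elim/tensor_ind: t => y z.
  by rewrite /= tensor_lactE !tensor_assoc_inv_funE tensor_lactE /= tensor_lactE.
- elim/tensor_ind => x t n; elim/tensor_ind: t => y z.
  rewrite /= tensor_ractE tensor_assoc_inv_funE /= tensor_ractE.
  by rewrite tensor_assoc_inv_funE tensor_ractE.
Defined.

End TensorAssoc.

Section TensorUnit.
Variables (M N : monoidType) (X : biset M N).

Definition tensor_lunit_fun : tensor (regular_biset M) X -> X :=
  tensor_lift (fun (m : regular_biset M) x => lact m x).

Definition tensor_runit_fun : tensor X (regular_biset N) -> X :=
  tensor_lift (fun x (n : regular_biset N) => ract x n).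

Lemma tensor_lunit_funE m x :
  tensor_lunit_fun (tpair (m : regular_biset M) x) = lact m x.
Proof. by rewrite /tensor_lunit_fun tensor_liftE //= => *; rewrite lactM. Qed.

Lemma tensor_runit_funE x n :
  tensor_runit_fun (tpair x (n : regular_biset N)) = ract x n.
Proof. by rewrite /tensor_runit_fun tensor_liftE //= => *; rewrite ractM. Qed.

Definition tensor_lunit : biset_hom (tensor (regular_biset M) X) X.
Proof.
exists tensor_lunit_fun => [m|].
- elim/tensor_ind => m' x.
  by rewrite /= tensor_lactE !tensor_lunit_funE lactM.
- elim/tensor_ind => m x n.
  by rewrite /= tensor_ractE !tensor_lunit_funE lractA.
Defined.

Definition tensor_runit : biset_hom (tensor X (regular_biset N)) X.
Proof.
exists tensor_runit_fun => [m|].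
- elim/tensor_ind => x n.
  by rewrite /= tensor_lactE !tensor_runit_funE lractA.
- elim/tensor_ind => x n n'.
  by rewrite /= tensor_ractE !tensor_runit_funE ractM.
Defined.

Definition tensor_lunit_inv : biset_hom X (tensor (regular_biset M) X).
Proof.
exists (fun x => tpair (1 : regular_biset M) x) => [m x|x n].
- by rewrite /= tensor_lactE -tpair_bal /= mul1g mulg1.
- by rewrite /= tensor_ractE.
Defined.

Definition tensor_runit_inv : biset_hom X (tensor X (regular_biset N)).
Proof.
exists (fun x => tpair x (1 : regular_biset N)) => [m x|x n].
- by rewrite /= tensor_lactE.
- by rewrite /= tensor_ractE tpair_bal /= mul1g mulg1.
Defined.

End TensorUnit.

Definition End_Biset (N : monoidType) : moncat.
Proof.
refine (@MonCat (biset_category N N) (@tensor N N N) (@tensor_hom N N N)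
  (regular_biset N) (@tensor_assoc N N N N)
  (@tensor_lunit N N) (@tensor_runit N N) _ _ _ _ _ _ _ _ _ _).
- move=> X Y; apply: biset_hom_ext; elim/tensor_ind => x y.
  by rewrite /= tensor_mapE.
- move=> X X' X'' Y Y' Y'' f f' g g'; apply: biset_hom_ext.
  by elim/tensor_ind => x y; rewrite /= !tensor_mapE.
- move=> X X' Y Y' Z Z' f g h; apply: biset_hom_ext.
  elim/tensor_ind => t z; elim/tensor_ind: t => x y.
  by rewrite /= tensor_mapE /= tensor_mapE !tensor_assoc_funE tensor_mapE /= tensor_mapE.
- move=> X X' f; apply: biset_hom_ext; elim/tensor_ind => n x.
  by rewrite /= tensor_mapE !tensor_lunit_funE bfun_lact.
- move=> X X' f; apply: biset_hom_ext; elim/tensor_ind => x n.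
  by rewrite /= tensor_mapE !tensor_runit_funE bfun_ract.
- move=> X Y Z; exists (tensor_assoc_inv X Y Z); split; apply: biset_hom_ext.
  + elim/tensor_ind => t z; elim/tensor_ind: t => x y.
    by rewrite /= tensor_assoc_funE tensor_assoc_inv_funE.
  + elim/tensor_ind => x t; elim/tensor_ind: t => y z.
    by rewrite /= tensor_assoc_inv_funE tensor_assoc_funE.
- move=> X; exists (tensor_lunit_inv X); split; apply: biset_hom_ext.
  + elim/tensor_ind => n x.
    by rewrite /= tensor_lunit_funE -tpair_bal /= mul1g.
  + by move=> x; rewrite /= tensor_lunit_funE lact1.
- move=> X; exists (tensor_runit_inv X); split; apply: biset_hom_ext.
  + elim/tensor_ind => x n.
    by rewrite /= tensor_runit_funE tpair_bal /= mulg1.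
  + by move=> x; rewrite /= tensor_runit_funE ract1.
- move=> X Y; apply: biset_hom_ext.
  elim/tensor_ind => t y; elim/tensor_ind: t => x n.
  by rewrite /= tensor_assoc_funE !tensor_mapE /= tensor_lunit_funE
    tensor_runit_funE tpair_bal.
- move=> X Y Z W; apply: biset_hom_ext.
  elim/tensor_ind => t w; elim/tensor_ind: t => t z; elim/tensor_ind: t => x y.
  by rewrite /= tensor_mapE /= !tensor_assoc_funE tensor_mapE /= tensor_assoc_funE.
Defined.

(* q exhibits X, with its left action only, as a quotient of the left M-set M;
   q is not part of the data and need not respect the right action. *)
Definition left_quotient (M N : monoidType) (X : biset M N) : Prop :=
  exists q : M -> X,
    (forall m m', q (m * m') = lact m (q m')) /\ (forall x, exists m, q m = x).

Lemma left_quotient_regular (N : monoidType) : left_quotient (regular_biset N).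
Proof. by exists id; split=> // x; exists x. Qed.

Lemma left_quotient_tensor (L M N : monoidType) (X : biset L M) (Y : biset M N) :
  left_quotient X -> left_quotient Y -> left_quotient (tensor X Y).
Proof.
case=> [q [qM qsurj]] [r [rM rsurj]].
exists (fun l => tpair (q l) (r 1)); split.
  by move=> l l'; rewrite /= tensor_lactE qM.
elim/tensor_ind => x y; have [m <-] := rsurj y.
have [l ql] := qsurj (ract x m); exists l.
by rewrite ql tpair_bal -rM mulg1.
Qed.

Definition End_LQBiset (N : monoidType) : moncat :=
  @full_sub_moncat (End_Biset N) (@left_quotient N N) (left_quotient_regular N)
    (@left_quotient_tensor N N N).

Notation monoid_hom := UMagmaMorphism.type.

Lemma monoid_hom_ext (G H : monoidType) (f g : monoid_hom G H) :
  (forall x, f x = g x) -> f = g.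
Proof.
case: f g => [f [[f1] [fM]]] [g [[g1] [gM]]] /= fg.
have {}fg : f = g by apply: functional_extensionality_dep.
by subst g; rewrite (Prop_irrelevance f1 g1) (Prop_irrelevance fM gM).
Qed.

Definition is_kernel (N G H : monoidType)
    (k : monoid_hom N G) (e : monoid_hom G H) : Prop :=
  injective k /\ (forall g : G, e g = 1 <-> exists n, k n = g).

Definition is_cokernel (N G H : monoidType)
    (k : monoid_hom N G) (e : monoid_hom G H) : Prop :=
  (forall n, e (k n) = 1) /\
  (forall (T : monoidType) (f : monoid_hom G T), (forall n, f (k n) = 1) ->
    exists! f' : monoid_hom H T, forall g, f' (e g) = f g).

Record extension (N H : monoidType) := Extension {
  ext_mid : monoidType;
  ext_k : monoid_hom N ext_mid;
  ext_e : monoid_hom ext_mid H;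
  ext_kernel : is_kernel ext_k ext_e;
  ext_cokernel : is_cokernel ext_k ext_e }.

Definition weakly_schreier (N H : monoidType) (E : extension N H) : Prop :=
  forall h : H, exists u : ext_mid E, ext_e E u = h /\
    (forall g : ext_mid E, ext_e E g = h -> exists n : N, ext_k E n * u = g).

Record ext_hom (N H : monoidType) (E E' : extension N H) := ExtHom {
  ext_map :> monoid_hom (ext_mid E) (ext_mid E');
  ext_map_k : forall n, ext_map (ext_k E n) = ext_k E' n;
  ext_map_e : forall g, ext_e E' (ext_map g) = ext_e E g }.

Lemma ext_hom_ext (N H : monoidType) (E E' : extension N H) (s t : ext_hom E E') :
  (forall g, s g = t g) -> s = t.
Proof.
case: s t => [s sk se] [t tk te] /= /monoid_hom_ext st; subst t.
by rewrite (Prop_irrelevance sk tk) (Prop_irrelevance se te).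
Qed.

Definition ext_hom_id (N H : monoidType) (E : extension N H) : ext_hom E E :=
  @ExtHom N H E E idfun (fun _ => erefl) (fun _ => erefl).

Definition ext_hom_comp (N H : monoidType) (E E' E'' : extension N H)
  (t : ext_hom E' E'') (s : ext_hom E E') : ext_hom E E''.
Proof.
exists (t \o s : monoid_hom _ _) => [n|g] /=.
- by rewrite !ext_map_k.
- by rewrite !ext_map_e.
Defined.

Definition extension_category (N H : monoidType) : category.
Proof.
by refine (@Category (extension N H) (@ext_hom N H) (@ext_hom_id N H)
  (@ext_hom_comp N H) _ _ _) => *; apply: ext_hom_ext.
Defined.

Definition weakly_schreier_category (N H : monoidType) : category :=
  @full_subcat (extension_category N H) (@weakly_schreier N H).

(* Main.v *)
(* A normal lax functor L from H gives the monoid of pairs (x, a) with a in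
   L(x), multiplied through the structure maps: the unit map embeds N as the
   fibre over 1, and a generator of the left quotient L(x) of N provides the
   element u_x required of a weakly Schreier extension. Monoidal transformations
   correspond to morphisms of extensions fibre by fibre, so this functor is fully
   faithful. It is essentially surjective because the fibres e^-1(x) of a weakly
   Schreier extension are bisets, quotients of N on the left, multiplied by the
   monoid structure; for normality the fibre over 1 is replaced by N itself. *)
From HB Require Import structures.
Require Import Defs.
From mathcomp Require Import all_boot.
From mathcomp Require Import boolp.

Set Implicit Arguments.
Unset Strict Implicit.
Unset Printing Implicit Defensive.

Local Open Scope group_scope.

(* Comparing unfolded bisets and categories field by field is prohibitively
   slow, so conversion must try to unify their arguments first. *)
Local Strategy 1000 [tensor tensor_hom tensor_assoc
  tensor_lunit tensor_runit biset_hom_comp biset_hom_id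
  full_subcat biset_category discrete_category lax_category].

(** * Fully faithful, essentially surjective functors are equivalences *)

Section EquivalenceCriterion.
Variables (C D : category) (F : functor C D).
Hypothesis F_faithful : forall (X Y : C) (f g : hom X Y),
  fmap F f = fmap F g -> f = g.
Hypothesis F_full : forall (X Y : C) (g : hom (F X) (F Y)),
  exists f : hom X Y, fmap F f = g.
Hypothesis F_eso : forall Y : D, exists (X : C) (f : hom (F X) Y), is_iso f.

Lemma equivalent_categories_of_fully_faithful : equivalent_categories D C.
Proof.
(* Choice must return data, so each object of [D] gets a preimage together with both directions of
   the isomorphism. *)
have /all_sig[G GP] : forall Y : D, {Xfg :
    {X : C & (hom (F X) Y * hom Y (F X))%type} |
    (tagged Xfg).2 ∘ (tagged Xfg).1 = idm _ /\
    (tagged Xfg).1 ∘ (tagged Xfg).2 = idm _}.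
  move=> Y; apply: cid; have [X [f [g fg]]] := F_eso Y.
  by exists (existT _ X (f, g)).
pose ob Y := tag (G Y).
pose c Y : hom (F (ob Y)) Y := (tagged (G Y)).1.
pose d Y : hom Y (F (ob Y)) := (tagged (G Y)).2.
have dc Y : d Y ∘ c Y = idm _ by have [] := GP Y.
have cd Y : c Y ∘ d Y = idm _ by have [] := GP Y.
have preim X Y (g : hom (F X) (F Y)) : {f | fmap F f = g}.
  exact: cid (F_full g).
(* The quasi-inverse on morphisms conjugates by the chosen isomorphisms and lifts along [F];
   faithfulness of [F] then gives the functor laws. *)
pose Gm X Y (f : hom X Y) := sval (preim _ _ (d Y ∘ f ∘ c X)).
have GmE X Y (f : hom X Y) : fmap F (Gm _ _ f) = d Y ∘ f ∘ c X.
  by rewrite /Gm; case: (preim _ _ _).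
have Gm1 X : Gm X X (idm X) = idm (ob X).
  by apply: F_faithful; rewrite GmE fmap_id comp_idr.
have GmM X Y Z (f : hom X Y) (g : hom Y Z) :
    Gm _ _ (g ∘ f) = Gm _ _ g ∘ Gm _ _ f.
  apply: F_faithful; rewrite fmap_comp !GmE.
  by rewrite -!comp_assoc (comp_assoc _ (d Y)) cd comp_idl.
pose GF := Functor Gm1 GmM.
have c_nat X Y (f : hom X Y) : c Y ∘ fmap (functor_comp F GF) f = f ∘ c X.
  by rewrite /= GmE !comp_assoc cd comp_idl.
(* The second natural isomorphism is the lift of [c] at objects in the image of [F]; its naturality
   and its inverse are obtained by faithfulness from those of [c]. *)
have [u uP] : {u : forall X, hom (ob (F X)) X |
    forall X, fmap F (u X) = c (F X)}.
  by apply: (all_sig (fun X => preim _ _ (c (F X)))).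
have u_nat X Y (f : hom X Y) : u Y ∘ fmap (functor_comp GF F) f = f ∘ u X.
  by apply: F_faithful; rewrite !fmap_comp !uP; apply: c_nat.
exists GF, F; split.
- exists (@NatTrans _ _ (functor_comp F GF) (functor_id D) c c_nat) => X.
  by exists (d X); split; [apply: dc | apply: cd].
- exists (@NatTrans _ _ (functor_comp GF F) (functor_id C) u u_nat) => X.
  have [v vP] := F_full (d (F X)); exists v.
  by split; apply: F_faithful; rewrite fmap_comp [RHS]fmap_id uP vP;
    [apply: dc | apply: cd].
Qed.

End EquivalenceCriterion.

Lemma is_iso_is_identity (C : category) (X Y : C) (f : hom X Y) :
  is_identity f -> is_iso f.
Proof. by case=> {Y f}; exists (idm X); rewrite comp_idl. Qed.

Lemma biset_hom_congr (M N : monoidType) (X Y : biset M N)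
    (f g : biset_hom X Y) :
  f = g -> forall x, f x = g x.
Proof. by move=> ->. Qed.

(** * The extension attached to a normal lax functor *)

Section TotalMonoid.
Variables (N H : monoidType).
Variable L : lax_functor (discrete_moncat H) (End_LQBiset N).

Definition fibre (x : H) : biset N N := sval (L x).

(** Transport goes through the action of [L] on the morphisms of the discrete category, since this
    is the form in which it occurs in the lax axioms. *)
Definition fibre_cast (x y : H) (p : x = y) : biset_hom (fibre x) (fibre y) :=
  @fmap _ _ L x y p.

Definition fibre_unit : biset_hom (regular_biset N) (fibre 1) := lax_unit L.

Definition fibre_mult (x y : H) :
    biset_hom (tensor (fibre x) (fibre y)) (fibre (x * y)) :=
  lax_mult L x y.

Lemma fibre_cast_id x (p : x = x) a : fibre_cast p a = a.
Proof.
rewrite (Prop_irrelevance p erefl).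
exact: (@biset_hom_congr _ _ (fibre x) (fibre x) _ _ (fmap_id L x)).
Qed.

Lemma fibre_multA x y z (a : fibre x) (b : fibre y) (c : fibre z) :
  fibre_cast (esym (mulgA x y z))
    (fibre_mult _ _ (tpair (fibre_mult _ _ (tpair a b)) c)) =
  fibre_mult _ _ (tpair a (fibre_mult _ _ (tpair b c))).
Proof.
have /= E := lax_assoc L x y z.
have := biset_hom_congr E (tpair (tpair a b : tensor (fibre x) (fibre y)) c).
by rewrite /= tensor_mapE tensor_assoc_funE tensor_mapE.
Qed.

Lemma fibre_unit_mult x (n : N) (a : fibre x) :
  fibre_cast (mul1g x) (fibre_mult _ _ (tpair (fibre_unit n) a)) = lact n a.
Proof.
have /= E := lax_lunit L x.
have := biset_hom_congr E (tpair (n : regular_biset N) a).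
by rewrite /= tensor_mapE tensor_lunit_funE.
Qed.

Lemma fibre_mult_unit x (a : fibre x) (n : N) :
  fibre_cast (mulg1 x) (fibre_mult _ _ (tpair a (fibre_unit n))) = ract a n.
Proof.
have /= E := lax_runit L x.
have := biset_hom_congr E (tpair a (n : regular_biset N)).
by rewrite /= tensor_mapE tensor_runit_funE.
Qed.

(** This is the Grothendieck construction of [L]. *)
Definition total_monoid : Type := {x : H & fibre x}.

Definition total_pair x (a : fibre x) : total_monoid := existT _ x a.

Lemma total_eqP (u v : total_monoid) (p : tag u = tag v) :
  u = v <-> fibre_cast p (tagged u) = tagged v.
Proof.
split=> [uv|]; first by subst v; rewrite fibre_cast_id.
case: u v p => [x a] [y b] /= p; subst y.
by rewrite fibre_cast_id => ->.
Qed.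

(** Casts disappear in the total space, so the lax axioms, which hold only up to a cast, become
    strict monoid laws. *)
Lemma total_pair_cast x y (p : x = y) a :
  total_pair (fibre_cast p a) = total_pair a.
Proof. by subst y; rewrite fibre_cast_id. Qed.

Lemma total_pair_inj x : injective (@total_pair x).
Proof. move=> a b /(proj1 (@total_eqP (total_pair a) (total_pair b) erefl)) /=.
by rewrite fibre_cast_id. Qed.

Definition total_mul (u v : total_monoid) : total_monoid :=
  total_pair (fibre_mult _ _ (tpair (tagged u) (tagged v))).

Definition total_one : total_monoid := total_pair (fibre_unit 1).

Lemma total_mulA : associative total_mul.
Proof.
by move=> [x a] [y b] [z c]; rewrite /total_mul /= -fibre_multA total_pair_cast.
Qed.

(** By the unit axiom, acting by [n] is multiplying by the image of [n]; facts about actions can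
    thus be checked in the monoid. *)
Lemma total_mul_unitl x n (a : fibre x) :
  total_mul (total_pair (fibre_unit n)) (total_pair a) = total_pair (lact n a).
Proof. by rewrite -fibre_unit_mult total_pair_cast. Qed.

Lemma total_mul_unitr x (a : fibre x) n :
  total_mul (total_pair a) (total_pair (fibre_unit n)) = total_pair (ract a n).
Proof. by rewrite -fibre_mult_unit total_pair_cast. Qed.

Lemma total_mul1 : left_id total_one total_mul.
Proof. by move=> [x a]; rewrite total_mul_unitl lact1. Qed.

Lemma total_mulr1 : right_id total_one total_mul.
Proof. by move=> [x a]; rewrite total_mul_unitr ract1. Qed.

HB.instance Definition _ := gen_eqMixin total_monoid.
HB.instance Definition _ := gen_choiceMixin total_monoid.
HB.instance Definition _ :=
  isMonoid.Build total_monoid total_mulA total_mul1 total_mulr1.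

Definition total_k (n : N) : total_monoid := total_pair (fibre_unit n).

Definition total_e (u : total_monoid) : H := tag u.

(** Multiplying by a unit element is acting by it, and [fibre_unit] commutes with the left
    action. *)
Lemma total_k_morphism : monoid_morphism total_k.
Proof.
split=> // m n; rewrite [RHS]total_mul_unitl; congr total_pair.
exact: (bfun_lact fibre_unit m n).
Qed.

HB.instance Definition _ :=
  isUMagmaMorphism.Build N total_monoid total_k total_k_morphism.

Lemma total_e_morphism : monoid_morphism total_e.
Proof. by []. Qed.

HB.instance Definition _ :=
  isUMagmaMorphism.Build total_monoid H total_e total_e_morphism.

(** A map of left [N]-sets out of [N] is determined by its value at 1, so the image of 1 generates
    the quotient. *)
Lemma total_generator x : exists u : fibre x, forall a, exists n, lact n u = a.
Proof.
have [q [qM qsurj]] := proj2_sig (L x); exists (q 1) => a.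
by have [n <-] := qsurj a; exists n; rewrite -qM mulg1.
Qed.

(** Every element of a fibre is the generator multiplied by the image of some [n], which [f] sends
    to 1; hence [f] is constant on fibres. *)
Lemma total_cokernel :
  is_cokernel (total_k : monoid_hom _ _) (total_e : monoid_hom _ _).
Proof.
split=> // T f fk.
have [u uP] := all_tag (fun x => cid (total_generator x)).
have fE x (a : fibre x) : f (total_pair a) = f (total_pair (u x)).
  have [n <-] := uP x a.
  rewrite -total_mul_unitl; transitivity (f (total_k n) * f (total_pair (u x))).
    exact: gmulfM.
  by rewrite fk mul1g.
pose f' x := f (total_pair (u x)).
have f'M : monoid_morphism f'.
  split=> [|x y]; rewrite /f'.
    by rewrite -(fE _ (fibre_unit 1)) [LHS]gmulf1.
  (* The product of the generators over [x] and [y] need not be the chosen generator over [x * y],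
     but it lies in the same fibre. *)
  by rewrite -gmulfM fE.
pose B := isUMagmaMorphism.Build H T f' f'M.
pose F : monoid_hom H T := HB.pack f' B.
exists F; split=> [[x a]|g gP]; first by rewrite [RHS]fE.
(* Uniqueness: every fibre contains its generator, so [total_e] is surjective. *)
by apply: monoid_hom_ext => x; rewrite [RHS](gP (total_pair (u x))).
Qed.

Hypothesis L_normal : normal L.

Lemma fibre_unit_bij : bijective fibre_unit.
Proof.
have [g [gK Kg]] := is_iso_is_identity L_normal.
exists (g : biset_hom _ _) => a.
- exact: (@biset_hom_congr _ _ (regular_biset N) (regular_biset N) _ _ gK).
- exact: (@biset_hom_congr _ _ (fibre 1) (fibre 1) _ _ Kg).
Qed.

(** Normality makes [fibre_unit] bijective, so the fibre over 1 is exactly the embedded copy of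
    [N]. *)
Lemma total_kernel :
  is_kernel (total_k : monoid_hom _ _) (total_e : monoid_hom _ _).
Proof.
have [g gK Kg] := fibre_unit_bij.
split=> [m n /total_pair_inj/(can_inj gK)//|[x a]]; split=> [|[n <-]] //.
rewrite /= /total_e /= => xE; subst x.
by exists (g a); rewrite /= /total_k Kg.
Qed.

Definition total_extension : extension N H :=
  Extension total_kernel total_cokernel.

Lemma total_weakly_schreier : weakly_schreier total_extension.
Proof.
move=> x; have [u uP] := total_generator x.
exists (total_pair u); split=> // -[y a] /= yx.
rewrite /total_e /= in yx; subst y.
by have [n <-] := uP a; exists n; rewrite [LHS]total_mul_unitl.
Qed.

End TotalMonoid.

(** * Morphisms of extensions from monoidal transformations *)

Lemma lq_compE (N : monoidType) (X Y Z : End_LQBiset N) (f : hom X Y)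
    (g : hom Y Z) (a : sval X) :
  (g ∘ f : biset_hom (sval X) (sval Z)) a =
  (g : biset_hom (sval Y) (sval Z)) ((f : biset_hom (sval X) (sval Y)) a).
Proof. by []. Qed.

Section TotalHom.
Variables (N H : monoidType).
Variables (L1 L2 : lax_functor (discrete_moncat H) (End_LQBiset N)).
Variable t : mon_trans L1 L2.

Definition fibre_map (x : H) : biset_hom (fibre L1 x) (fibre L2 x) := t x.

Lemma fibre_map_unit n : fibre_map 1 (fibre_unit L1 n) = fibre_unit L2 n.
Proof.
exact: (@biset_hom_congr _ _ (regular_biset N) (fibre L2 1) _ _ (mt_unit t)).
Qed.

Lemma fibre_map_mult x y (a : fibre L1 x) (b : fibre L1 y) :
  fibre_map (x * y) (fibre_mult L1 x y (tpair a b)) =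
  fibre_mult L2 x y (tpair (fibre_map x a) (fibre_map y b)).
Proof.
have /= E := mt_mult t x y.
by have := biset_hom_congr E (tpair a b); rewrite /= tensor_mapE.
Qed.

Definition total_map (u : total_monoid L1) : total_monoid L2 :=
  total_pair (fibre_map (tag u) (tagged u)).

Lemma total_map_morphism : monoid_morphism total_map.
Proof.
split=> [|[x a] [y b]]; congr total_pair; first exact: fibre_map_unit.
exact: fibre_map_mult.
Qed.

HB.instance Definition _ :=
  isUMagmaMorphism.Build (total_monoid L1) (total_monoid L2) total_map
    total_map_morphism.

Hypotheses (L1_normal : normal L1) (L2_normal : normal L2).

Definition total_hom :
  ext_hom (total_extension L1_normal) (total_extension L2_normal).
Proof.
exists (total_map : monoid_hom _ _) => [n|//].
by congr total_pair; apply: fibre_map_unit.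
Defined.

End TotalHom.

Section TotalHomComp.
Variables (N H : monoidType).
Variables (L1 L2 L3 : lax_functor (discrete_moncat H) (End_LQBiset N)).
Variables (t : mon_trans L2 L3) (s : mon_trans L1 L2).

Lemma fibre_map_comp x : fibre_map (mon_trans_comp t s) x = t x ∘ s x.
Proof. by []. Qed.

Lemma fibre_map_compE x a :
  fibre_map (mon_trans_comp t s) x a = fibre_map t x (fibre_map s x a).
Proof. rewrite fibre_map_comp; exact: (lq_compE (s x) (t x)). Qed.

Lemma total_map_comp u :
  total_map (mon_trans_comp t s) u = total_map t (total_map s u).
Proof.
case: u => x a.
exact: (congr1 (@total_pair _ _ L3 x) (fibre_map_compE a)).
Qed.

End TotalHomComp.

(** * Faithfulness and fullness *)

Lemma total_hom_inj (N H : monoidType)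
    (L1 L2 : lax_functor (discrete_moncat H) (End_LQBiset N))
    (n1 : normal L1) (n2 : normal L2) (s t : mon_trans L1 L2) :
  total_hom s n1 n2 = total_hom t n1 n2 -> s = t.
Proof.
move=> st; apply: mon_trans_ext => x.
apply: (@biset_hom_ext _ _ _ _ (fibre_map s x) (fibre_map t x)) => a.
have E : total_map s (total_pair a) = total_map t (total_pair a).
  exact: (congr1 (fun f : ext_hom (total_extension n1) (total_extension n2) =>
    ext_map f (total_pair a)) st).
exact: total_pair_inj E.
Qed.

Section TotalHomFull.
Variables (N H : monoidType).
Variables (L1 L2 : lax_functor (discrete_moncat H) (End_LQBiset N)).
Hypotheses (n1 : normal L1) (n2 : normal L2).
Variable g : ext_hom (total_extension n1) (total_extension n2).

Let f (u : total_monoid L1) : total_monoid L2 := ext_map g u.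

Let f_tag u : tag (f u) = tag u := ext_map_e g u.

Let f_k n : f (total_k L1 n) = total_k L2 n := ext_map_k g n.

Let fM u v : f (u * v) = f u * f v.
Proof. exact: gmulfM. Qed.

(** A morphism over [H] preserves the base point only up to a propositional equality, hence the
    cast. *)
Definition total_fibre_fun x (a : fibre L1 x) : fibre L2 x :=
  fibre_cast L2 (f_tag (total_pair a)) (tagged (f (total_pair a))).

Lemma total_fibre_funE x (a : fibre L1 x) :
  total_pair (total_fibre_fun a) = f (total_pair a).
Proof. by rewrite total_pair_cast; case: (f _). Qed.

(** Both actions are multiplications by the image of [N], and [g] respects products and the
    embeddings of [N]. *)
Lemma total_fibre_fun_lact x n (a : fibre L1 x) :
  total_fibre_fun (lact n a) = lact n (total_fibre_fun a).
Proof.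
apply: total_pair_inj; rewrite total_fibre_funE -!total_mul_unitl.
by rewrite [LHS]fM [f _]f_k total_fibre_funE.
Qed.

Lemma total_fibre_fun_ract x (a : fibre L1 x) n :
  total_fibre_fun (ract a n) = ract (total_fibre_fun a) n.
Proof.
apply: total_pair_inj; rewrite total_fibre_funE -!total_mul_unitr.
by rewrite [LHS]fM [f (total_k _ _)]f_k total_fibre_funE.
Qed.

Definition total_fibre_hom x : biset_hom (fibre L1 x) (fibre L2 x) :=
  BisetHom (@total_fibre_fun_lact x) (@total_fibre_fun_ract x).

Lemma total_fibre_hom_natural (x y : discrete_moncat H) (p : hom x y) :
  (total_fibre_hom y : hom (L1 y) (L2 y)) ∘ fmap L1 p =
  fmap L2 p ∘ (total_fibre_hom x : hom (L1 x) (L2 x)).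
Proof.
case: y / p; rewrite [fmap L1 _](fmap_id L1) [fmap L2 _](fmap_id L2).
by rewrite comp_idl comp_idr.
Qed.

Lemma total_fibre_hom_unit :
  (total_fibre_hom 1 : hom (L1 munit) (L2 munit)) ∘ lax_unit L1 = lax_unit L2.
Proof.
apply: (@biset_hom_ext _ _ (regular_biset N) (fibre L2 1)) => n.
apply: total_pair_inj; rewrite -[RHS]/(total_k L2 n) -f_k.
exact: (total_fibre_funE (fibre_unit L1 n)).
Qed.

Lemma total_fibre_hom_mult (x y : discrete_moncat H) :
  (total_fibre_hom (x * y) : hom (L1 (mtens x y)) (L2 (mtens x y))) ∘
    lax_mult L1 x y =
  lax_mult L2 x y ∘
    mtensm (total_fibre_hom x : hom (L1 x) (L2 x))
      (total_fibre_hom y : hom (L1 y) (L2 y)).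
Proof.
apply: (@biset_hom_ext _ _ (tensor (fibre L1 x) (fibre L1 y))
  (fibre L2 (x * y))).
elim/tensor_ind => a b; apply: total_pair_inj.
(* Seen in the total monoids, compatibility with the structure maps is the multiplicativity of
   [g]. *)
have E : f (total_pair (fibre_mult L1 x y (tpair a b))) =
    total_pair (fibre_mult L2 x y
      (tensor_hom (total_fibre_hom x) (total_fibre_hom y) (tpair a b))).
  rewrite [tensor_hom _ _ _]tensor_mapE.
  transitivity (f (total_pair a) * f (total_pair b)); first
    exact: (fM (total_pair a) (total_pair b)).
  by rewrite -!total_fibre_funE.
by rewrite -[RHS]E -total_fibre_funE.
Qed.

Definition total_fibre_trans : mon_trans L1 L2 :=
  @MonTrans _ _ L1 L2 (NatTrans total_fibre_hom_natural)
    total_fibre_hom_unit total_fibre_hom_mult.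

Lemma total_hom_fibre_trans : total_hom total_fibre_trans n1 n2 = g.
Proof. by apply: ext_hom_ext => -[x a]; apply: total_fibre_funE. Qed.

End TotalHomFull.

(** * The functor from normal lax functors to weakly Schreier extensions *)

Section TotalFunctor.
Variables N H : monoidType.
Let Lax := normal_lax_category (discrete_moncat H) (End_LQBiset N).

Definition total_ob (L : Lax) : weakly_schreier_category N H :=
  exist _ (total_extension (proj2_sig L))
    (total_weakly_schreier (proj2_sig L)).

Definition total_functor : functor Lax (weakly_schreier_category N H).
Proof.
refine (@Functor _ (weakly_schreier_category N H) total_ob
  (fun L1 L2 t => total_hom t (proj2_sig L1) (proj2_sig L2)) _ _).
- by move=> L; apply: ext_hom_ext => -[x a].
- by move=> L1 L2 L3 s t; apply: ext_hom_ext; apply: total_map_comp.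
Defined.

Lemma total_functor_faithful (L1 L2 : Lax) (s t : hom L1 L2) :
  fmap total_functor s = fmap total_functor t -> s = t.
Proof.
exact: total_hom_inj.
Qed.

Lemma total_functor_full (L1 L2 : Lax)
    (g : hom (total_functor L1) (total_functor L2)) :
  exists t : hom L1 L2, fmap total_functor t = g.
Proof. by exists (total_fibre_trans g); apply: total_hom_fibre_trans. Qed.

End TotalFunctor.

(** * The fibres of an extension as bisets *)

Section FibreModel.
Variables (N H : monoidType) (E : extension N H).
Local Notation G := (ext_mid E).
Local Notation k := (ext_k E).
Local Notation e := (ext_e E).

Lemma ext_ek n : e (k n) = 1.
Proof. by have [_ /(_ (k n))[_]] := ext_kernel E; apply; exists n. Qed.

(* The last field makes the fibre over 1 equal, not just isomorphic, to the unit
   biset, as normality demands; a subset of G could not satisfy it. *)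
Record fibre_model (h : H) := FibreModel {
  model_ob : End_LQBiset N;
  model_val : sval model_ob -> G;
  model_val_inj : injective model_val;
  model_valP : forall a, e (model_val a) = h;
  model_surj : forall g, e g = h -> exists a, model_val a = g;
  model_lact : forall n a, model_val (lact n a) = k n * model_val a;
  model_ract : forall a n, model_val (ract a n) = model_val a * k n;
  model_unit : h = 1 -> exists u : hom munit model_ob,
    is_identity u /\
    forall n,
      model_val ((u : biset_hom (regular_biset N) (sval model_ob)) n) = k n }.

Section FibreBiset.
Variable h : H.

Definition fibre_carrier : Type := {g : G | e g == h}.

Fact fibre_lact_subproof n (a : fibre_carrier) : e (k n * val a) == h.
Proof. by rewrite gmulfM ext_ek mul1g; apply: valP a. Qed.

Fact fibre_ract_subproof (a : fibre_carrier) n : e (val a * k n) == h.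
Proof. by rewrite gmulfM ext_ek mulg1; apply: valP a. Qed.

Definition fibre_biset : biset N N.
Proof.
exists fibre_carrier
  (fun n a => exist (fun g : G => e g == h) _ (fibre_lact_subproof n a))
  (fun a n => exist (fun g : G => e g == h) _ (fibre_ract_subproof a n)).
- by move=> a; apply: val_inj; rewrite /= gmulf1 mul1g.
- by move=> m n a; apply: val_inj; rewrite /= gmulfM mulgA.
- by move=> a; apply: val_inj; rewrite /= gmulf1 mulg1.
- by move=> a m n; apply: val_inj; rewrite /= gmulfM mulgA.
- by move=> m a n; apply: val_inj; rewrite /= mulgA.
Defined.

End FibreBiset.

Hypothesis E_ws : weakly_schreier E.

(** The element [u] of the weakly Schreier condition generates the fibre, so acting on it is a
    surjection from [N]. *)
Lemma left_quotient_fibre h : left_quotient (fibre_biset h).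
Proof.
have [u [/eqP uh uP]] := E_ws h.
exists (fun n => lact n (exist (fun g : G => e g == h) u uh : fibre_biset h)).
split.
  by move=> m n; rewrite lactM.
move=> [g gh]; have [n ng] := uP g (eqP gh).
by exists n; apply: val_inj.
Qed.

Lemma weakly_schreier_fibre_model h : fibre_model h.
Proof.
(* Over 1 the model is the unit biset itself, embedded by [k], which maps bijectively onto that
   fibre because it is a kernel. Over any other [h] the actual fibre is used, and [model_unit] holds
   vacuously. *)
have [->|h1] := pselect (h = 1).
  have [k_inj kP] := ext_kernel E.
  apply: (@FibreModel 1 munit (k : regular_biset N -> G)) => //.
  - exact: ext_ek.
  - by move=> g /kP.
  - by move=> m n; apply: gmulfM.
  - by move=> m n; apply: gmulfM.
  - by exists (idm munit); split; first exact: is_identity_idm.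
apply: (@FibreModel h (exist _ _ (left_quotient_fibre h))
  (fun a : fibre_carrier h => val a)) => //.
- exact: val_inj.
- by move=> a; apply/eqP/(valP a).
- by move=> g /eqP gh; exists (exist _ g gh).
Qed.

End FibreModel.

(** * The normal lax functor of a weakly Schreier extension *)

Section FibreFunctor.
Variables (N H : monoidType) (E : extension N H).
Variable m : forall h, fibre_model E h.
Local Notation k := (ext_k E).
Local Notation e := (ext_e E).

Definition model_biset (h : H) : biset N N := sval (model_ob (m h)).

(** All equations below are verified after applying this injection into the middle monoid, where
    associativity settles them; the case distinction on [h] never reappears. *)
Definition model_psi (h : H) : model_biset h -> ext_mid E :=
  @model_val _ _ _ _ (m h).

Local Notation X := model_biset.
Local Notation psi := (@model_psi _).

Let psi_inj h (a b : X h) : psi a = psi b -> a = b.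
Proof. exact: model_val_inj. Qed.

Let psi_lact h n (a : X h) : psi (lact n a) = k n * psi a :=
  @model_lact _ _ _ _ (m h) n a.

Let psi_ract h (a : X h) n : psi (ract a n) = psi a * k n :=
  @model_ract _ _ _ _ (m h) a n.

Fact model_lift_subproof h g : e g = h -> {a : X h | psi a = g}.
Proof. by move=> gh; apply: cid; apply: (model_surj (m h)). Qed.

Fact model_mul_subproof x y (a : X x) (b : X y) : e (psi a * psi b) = x * y.
Proof. by rewrite gmulfM (model_valP a) (model_valP b). Qed.

Definition model_mul x y (a : X x) (b : X y) : X (x * y) :=
  sval (model_lift_subproof (model_mul_subproof a b)).

Lemma model_mulE x y (a : X x) (b : X y) : psi (model_mul a b) = psi a * psi b.
Proof. by rewrite /model_mul; case: (model_lift_subproof _). Qed.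

Lemma model_mul_bal x y (a : X x) n (b : X y) :
  model_mul (ract a n) b = model_mul a (lact n b).
Proof.
by apply: psi_inj; rewrite !model_mulE psi_ract psi_lact mulgA.
Qed.

Definition model_mult_fun x y : tensor (X x) (X y) -> X (x * y) :=
  tensor_lift (@model_mul x y).

Lemma model_mult_funE x y (a : X x) (b : X y) :
  psi (model_mult_fun (tpair a b)) = psi a * psi b.
Proof.
by rewrite /model_mult_fun tensor_liftE ?model_mulE //; apply: model_mul_bal.
Qed.

Fact model_mult_fun_lact x y n (t : tensor (X x) (X y)) :
  model_mult_fun (lact n t) = lact n (model_mult_fun t).
Proof.
elim/tensor_ind: t => a b; apply: psi_inj.
by rewrite psi_lact /= tensor_lactE !model_mult_funE psi_lact mulgA.
Qed.

Fact model_mult_fun_ract x y (t : tensor (X x) (X y)) n :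
  model_mult_fun (ract t n) = ract (model_mult_fun t) n.
Proof.
elim/tensor_ind: t => a b; apply: psi_inj.
by rewrite psi_ract /= tensor_ractE !model_mult_funE psi_ract mulgA.
Qed.

Definition model_mult x y : biset_hom (tensor (X x) (X y)) (X (x * y)) :=
  BisetHom (@model_mult_fun_lact x y) (@model_mult_fun_ract x y).

(** Matching on [p] makes the cast along [erefl] compute to the identity, so functoriality on
    identities is immediate. *)
Definition model_cast x y (p : x = y) : biset_hom (X x) (X y) :=
  let: erefl := p in biset_hom_id (X x).

Lemma model_castE x y (p : x = y) a : psi (model_cast p a) = psi a.
Proof. by case: y / p. Qed.

Definition model_functor : functor (discrete_moncat H) (End_LQBiset N).
Proof.
refine (@Functor (discrete_moncat H) (End_LQBiset N)
  (fun h => model_ob (m h)) model_cast _ _) => //.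
move=> x y z p q; apply: (@biset_hom_ext _ _ (X x) (X z)) => a.
by apply: psi_inj; rewrite model_castE [RHS]model_castE model_castE.
Defined.

(** The unit map is taken from the model over 1, which supplies it with a proof that it is an
    identity morphism. *)
Definition model_unit_hom : biset_hom (regular_biset N) (X 1) :=
  sval (cid (model_unit (m 1) erefl)).

Lemma model_unitE n : psi (model_unit_hom n) = k n.
Proof. by rewrite /model_unit_hom; case: (cid _) => u [_ uk] /=; apply: uk. Qed.

Fact model_mult_natural x x' y y' (p : x = x') (q : y = y') :
  biset_hom_comp (model_mult x' y') (tensor_hom (model_cast p) (model_cast q)) =
  biset_hom_comp (model_cast (f_equal2 (fun a b : H => a * b) p q))
    (model_mult x y).
Proof.
apply: biset_hom_ext; elim/tensor_ind => a b; apply: psi_inj.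
by rewrite /= model_castE tensor_mapE !model_mult_funE !model_castE.
Qed.

Fact model_mult_assoc x y z :
  biset_hom_comp (model_cast (esym (mulgA x y z)))
    (biset_hom_comp (model_mult (x * y) z)
      (tensor_hom (model_mult x y) (biset_hom_id (X z)))) =
  biset_hom_comp (model_mult x (y * z))
    (biset_hom_comp (tensor_hom (biset_hom_id (X x)) (model_mult y z))
      (tensor_assoc (X x) (X y) (X z))).
Proof.
apply: biset_hom_ext; elim/tensor_ind => t c; elim/tensor_ind: t => a b.
apply: psi_inj.
rewrite /= model_castE tensor_mapE tensor_assoc_funE tensor_mapE.
by rewrite !model_mult_funE mulgA.
Qed.

Fact model_mult_lunit x :
  biset_hom_comp (model_cast (mul1g x))
    (biset_hom_comp (model_mult 1 x)
      (tensor_hom model_unit_hom (biset_hom_id (X x)))) = tensor_lunit (X x).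
Proof.
apply: biset_hom_ext; elim/tensor_ind => n a; apply: psi_inj.
rewrite /= model_castE tensor_mapE tensor_lunit_funE model_mult_funE.
by rewrite model_unitE psi_lact.
Qed.

Fact model_mult_runit x :
  biset_hom_comp (model_cast (mulg1 x))
    (biset_hom_comp (model_mult x 1)
      (tensor_hom (biset_hom_id (X x)) model_unit_hom)) = tensor_runit (X x).
Proof.
apply: biset_hom_ext; elim/tensor_ind => a n; apply: psi_inj.
rewrite /= model_castE tensor_mapE tensor_runit_funE model_mult_funE.
by rewrite model_unitE psi_ract.
Qed.

Definition model_lax : lax_functor (discrete_moncat H) (End_LQBiset N) :=
  @LaxFunctor (discrete_moncat H) (End_LQBiset N) model_functor model_unit_hom
    model_mult model_mult_natural model_mult_assoc model_mult_lunit
    model_mult_runit.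

Lemma model_lax_normal : normal model_lax.
Proof. by rewrite /normal /= /model_unit_hom; case: (cid _) => u []. Qed.

Definition model_total_map (u : total_monoid model_lax) : ext_mid E :=
  model_psi (tagged u : X (tag u)).

Lemma model_total_map_morphism : monoid_morphism model_total_map.
Proof.
split=> [|[x a] [y b]]; last exact: model_mult_funE.
by transitivity (k 1); [apply: model_unitE | apply: gmulf1].
Qed.

HB.instance Definition _ := isUMagmaMorphism.Build (total_monoid model_lax)
  (ext_mid E) model_total_map model_total_map_morphism.

Definition model_total_hom :
  ext_hom (total_extension model_lax_normal) E.
Proof.
exists (model_total_map : monoid_hom _ _) => [|[x a]]; first exact: model_unitE.
exact: model_valP.
Defined.

Lemma model_total_map_bij : bijective model_total_map.
Proof.
pose inv g : total_monoid model_lax :=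
  existT _ (e g) (sval (model_lift_subproof (erefl (e g)))).
have invK : cancel inv model_total_map.
  by move=> g; rewrite /model_total_map /=; case: (model_lift_subproof _).
(* With a right inverse at hand only injectivity is left: [e] recovers the base point from the
   value, and the embedding of that fibre is injective. *)
exists inv => //; apply: inj_can_sym invK _ => -[x a] [y b] ab.
have xy : x = y by rewrite -(model_valP a) -(model_valP b); congr (e _).
by subst y; congr existT; apply: psi_inj.
Qed.

End FibreFunctor.

(** * Essential surjectivity and the equivalence *)

Lemma ext_hom_is_iso (N H : monoidType) (E E' : extension_category N H)
    (t : hom E E') : bijective (t : ext_hom _ _) -> is_iso t.
Proof.
case: t => t tk te /= [s tK sK].
(* The inverse function is a homomorphism because [t] is one and is injective; compatibility with
   [k] and [e] transfers the same way. *)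
have sM : monoid_morphism s.
  by split=> [|x y]; apply: (can_inj tK); rewrite ?gmulf1 ?gmulfM !sK ?gmulf1.
pose sP := isUMagmaMorphism.Build _ _ s sM.
pose S : monoid_hom (ext_mid E') (ext_mid E) := HB.pack s sP.
have Sk n : S (ext_k E' n) = ext_k E n by rewrite -tk; apply: tK.
have Se g : ext_e E (S g) = ext_e E' g.
  by rewrite -te; congr (ext_e E' _); apply: sK.
by exists (ExtHom Sk Se); split; apply: ext_hom_ext.
Qed.

Lemma total_functor_eso (N H : monoidType) (E : weakly_schreier_category N H) :
  exists L (f : hom (total_functor N H L) E), is_iso f.
Proof.
case: E => E E_ws.
pose m := weakly_schreier_fibre_model E_ws.
pose L : normal_lax_category (discrete_moncat H) (End_LQBiset N) :=
  exist _ (model_lax m) (model_lax_normal m).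
exists L, (model_total_hom m).
have [s st] := @ext_hom_is_iso _ _ (total_extension (model_lax_normal m)) E
  (model_total_hom m) (model_total_map_bij m).
by exists s.
Qed.

Theorem proposition5p4 (N H : monoidType) :
  equivalent_categories
    (weakly_schreier_category N H)
    (normal_lax_category (discrete_moncat H) (End_LQBiset N)).
Proof.
apply: (@equivalent_categories_of_fully_faithful _ _ (total_functor N H)).
- exact: total_functor_faithful.
- exact: total_functor_full.
- exact: total_functor_eso.
Qed.
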